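(* Let $n$ be a non-negative integer and $s$ any integer. Then \[ \sum_{j = 0}^n \frac{F_{j + n + s}}{\binom nj} = (n + 1)\sum_{j = 0}^n \frac{F_{j + s - 2} + F_{2j + s - 1}}{j + 1}, \qquad \sum_{j = 0}^n \frac{L_{j + n + s}}{\binom nj} = (n + 1)\sum_{j = 0}^n \frac{L_{j + s - 2} + L_{2j + s - 1}}{j + 1}. \]
   Context: $F_j$ and $L_j$ denote the Fibonacci and Lucas numbers, defined for all integers $j$ by $F_0=0$, $F_1=1$, $L_0=2$, $L_1=1$, $F_j=F_{j-1}+F_{j-2}$, $L_j=L_{j-1}+L_{j-2}$, extended to negative indices by $F_{-j}=(-1)^{j-1}F_j$, $L_{-j}=(-1)^jL_j$; equivalently $F_j=(\alpha^j-\beta^j)/(\alpha-\beta)$, $L_j=\alpha^j+\beta^j$ with $\alpha=(1+\sqrt5)/2$, $\beta=(1-\sqrt5)/2$. For non-negative integers $i,j$, $\binom ij=\frac{i!}{j!(i-j)!}$ if $i\ge j$. *)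

(* Defs.v *)
From mathcomp Require Import all_boot all_order all_algebra.

Set Implicit Arguments.
Unset Strict Implicit.
Unset Printing Implicit Defensive.

Import Order.TTheory GRing.Theory Num.Theory.

Local Open Scope ring_scope.

Fixpoint fibn (n : nat) : nat :=
  if n is n1.+1 then (if n1 is n2.+1 then fibn n1 + fibn n2 else 1)%N else 0%N.

Fixpoint lucn (n : nat) : nat :=
  if n is n1.+1 then (if n1 is n2.+1 then lucn n1 + lucn n2 else 1)%N else 2%N.

(* [Negz n] is the integer -(n+1), so F_{-j} = (-1)^(j-1) F_j and
   L_{-j} = (-1)^j L_j are read here with j = n+1. *)
Definition fib (j : int) : int :=
  match j with
  | Posz n => (fibn n)%:Z
  | Negz n => (-1) ^+ n * (fibn n.+1)%:Z
  end.

Definition luc (j : int) : int :=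
  match j with
  | Posz n => (lucn n)%:Z
  | Negz n => (-1) ^+ n.+1 * (lucn n.+1)%:Z
  end.

Lemma fibnSS (n : nat) : fibn n.+2 = (fibn n.+1 + fibn n)%N.
Proof. by []. Qed.

Lemma lucnSS (n : nat) : lucn n.+2 = (lucn n.+1 + lucn n)%N.
Proof. by []. Qed.

Lemma fib_rec (j : int) : fib j = fib (j - 1) + fib (j - 2).
Proof.
case: j => [[|[|n]]|n] //.
- have -> : n.+2%:Z - 1 = n.+1%:Z by rewrite -[n.+2]addn1 PoszD addrK.
  have -> : n.+2%:Z - 2 = n%:Z by rewrite -[n.+2]addn2 PoszD addrK.
  by rewrite /fib fibnSS PoszD.
- have -> : Negz n - 1 = Negz n.+1 by rewrite !NegzE -opprD -PoszD addn1.
  have -> : Negz n - 2 = Negz n.+2 by rewrite !NegzE -opprD -PoszD addn2.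
  rewrite /fib [fibn n.+3]fibnSS PoszD !exprS !mulN1r opprK mulNr mulrDr.
  by rewrite addKr.
Qed.

Lemma luc_rec (j : int) : luc j = luc (j - 1) + luc (j - 2).
Proof.
case: j => [[|[|n]]|n] //.
- have -> : n.+2%:Z - 1 = n.+1%:Z by rewrite -[n.+2]addn1 PoszD addrK.
  have -> : n.+2%:Z - 2 = n%:Z by rewrite -[n.+2]addn2 PoszD addrK.
  by rewrite /luc lucnSS PoszD.
- have -> : Negz n - 1 = Negz n.+1 by rewrite !NegzE -opprD -PoszD addn1.
  have -> : Negz n - 2 = Negz n.+2 by rewrite !NegzE -opprD -PoszD addn2.
  rewrite /luc [lucn n.+3]lucnSS PoszD !exprS !mulN1r !opprK !mulNr mulrDr.
  by rewrite opprD addNKr.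
Qed.

(* Main.v *)
Require Import Defs.
From mathcomp Require Import all_boot all_order all_algebra.
From mathcomp Require Import ring.

Set Implicit Arguments.
Unset Strict Implicit.
Unset Printing Implicit Defensive.

Import Order.TTheory GRing.Theory Num.Theory.

Local Open Scope ring_scope.

(** Since 1/C(n+1,j) + 1/C(n+1,j+1) = (n+2)/(n+1) * 1/C(n,j), regrouping the
    sum of (u_{j+1} + u_j)/C(n+1,j) over j <= n+1 by the values of u leaves
    u_0 + u_{n+2} and (n+2)/(n+1) times the sum of u_{j+1}/C(n,j) over j <= n.
    For u_j = G_{j+n+s-1} with G_j = G_{j-1} + G_{j-2}, this says that the sum
    of G_{j+n+s}/C(n,j), divided by n+1, grows by
    (G_{n+s-1} + G_{2n+s+1})/(n+2) when n is replaced by n+1. *)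

Definition gibonacci (V : zmodType) (G : int -> V) : Prop :=
  forall j, G j = G (j - 1) + G (j - 2).

Lemma gibonacci_raddf (U V : zmodType) (f : {additive U -> V}) (G : int -> U) :
  gibonacci G -> gibonacci (f \o G).
Proof. by move=> Grec j; rewrite /= -raddfD -Grec. Qed.

Section InverseBinomialSums.

Variable F : fieldType.
Hypothesis pcharF0 : [pchar F] =i pred0.

Let natrS_neq0 (n : nat) : n.+1%:R != 0 :> F.
Proof. by rewrite ((pcharf0P F).1 pcharF0). Qed.

Lemma invr_binS (n j : nat) : (j <= n)%N ->
  ('C(n.+1, j)%:R)^-1 = (n.+1 - j)%:R / (n.+1%:R * 'C(n, j)%:R) :> F.
Proof.
by move=> le_jn; rewrite -natrM mul_bin_down natrM subSn // invfM mulVKf.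
Qed.

Lemma invr_binSS (n j : nat) :
  ('C(n.+1, j.+1)%:R)^-1 = j.+1%:R / (n.+1%:R * 'C(n, j)%:R) :> F.
Proof. by rewrite -natrM mul_bin_diag natrM invfM mulVKf. Qed.

Lemma invr_binD (n j : nat) : (j <= n)%N ->
  ('C(n.+1, j)%:R)^-1 + ('C(n.+1, j.+1)%:R)^-1
  = n.+2%:R / n.+1%:R / 'C(n, j)%:R :> F.
Proof.
move=> le_jn; rewrite invr_binS // invr_binSS -mulrDl -natrD addnS.
by rewrite subnK ?leqW // invfM mulrA.
Qed.

Definition inv_bin_sum (u : nat -> F) (n : nat) : F :=
  \sum_(0 <= j < n.+1) u j / 'C(n, j)%:R.

Lemma inv_bin_sumS (u : nat -> F) (n : nat) :
  inv_bin_sum (fun j => u j.+1 + u j) n.+1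
  = n.+2%:R / n.+1%:R * inv_bin_sum (fun j => u j.+1) n + (u 0%N + u n.+2).
Proof.
have merge_binS : \sum_(0 <= j < n.+1) u j.+1 / 'C(n.+1, j)%:R
      + \sum_(0 <= j < n.+1) u j.+1 / 'C(n.+1, j.+1)%:R
    = n.+2%:R / n.+1%:R * inv_bin_sum (fun j => u j.+1) n.
  rewrite mulr_sumr -big_split; apply: eq_big_nat => j /andP[_ le_jn] /=.
  by rewrite -mulrDr invr_binD // mulrCA.
rewrite -merge_binS /inv_bin_sum; under eq_bigr do rewrite mulrDl.
rewrite big_split [X in X + _ = _]big_nat_recr //.
rewrite [X in _ + X = _]big_nat_recl //= bin0 binn !divr1.
by rewrite [X in _ + X = _]addrC addrACA [u 0%N + _]addrC.
Qed.

Lemma inv_bin_sum_gibonacci (G : int -> F) (n : nat) (s : int) :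
    gibonacci G ->
  inv_bin_sum (fun j => G (j%:Z + n%:Z + s)) n
  = n.+1%:R * \sum_(0 <= j < n.+1)
      (G (j%:Z + s - 2) + G (2 * j%:Z + s - 1)) / j.+1%:R.
Proof.
move=> Grec; elim: n => [|n IHn].
  rewrite /inv_bin_sum !big_nat1 bin0 !divr1 mul1r !add0r addrC.
  exact: Grec.
pose u j := G (j%:Z + n%:Z + s - 1).
have uS j : u j.+1 = G (j%:Z + n%:Z + s) by congr G; rewrite intS; ring.
have split_terms : inv_bin_sum (fun j => G (j%:Z + n.+1%:Z + s)) n.+1
    = inv_bin_sum (fun j => u j.+1 + u j) n.+1.
  apply: eq_bigr => j _; rewrite uS Grec.
  by congr ((G _ + G _) / _); rewrite intS; ring.
have shift_terms : inv_bin_sum (fun j => u j.+1) n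
    = inv_bin_sum (fun j => G (j%:Z + n%:Z + s)) n.
  by apply: eq_bigr => j _; rewrite uS.
rewrite split_terms inv_bin_sumS shift_terms IHn mulrA divfK //.
rewrite [in RHS]big_nat_recr //= mulrDr [n.+2%:R * (_ / _)]mulrC divfK //.
by congr (_ + (G _ + G _)); rewrite !intS; ring.
Qed.

End InverseBinomialSums.

Theorem theorem1 (n : nat) (s : int) :
  (\sum_(0 <= j < n.+1) (fib (j%:Z + n%:Z + s))%:Q / 'C(n, j)%:R
   = n.+1%:R * \sum_(0 <= j < n.+1)
       ((fib (j%:Z + s - 2))%:Q + (fib (2 * j%:Z + s - 1))%:Q) / j.+1%:R)
  /\
  (\sum_(0 <= j < n.+1) (luc (j%:Z + n%:Z + s))%:Q / 'C(n, j)%:R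
   = n.+1%:R * \sum_(0 <= j < n.+1)
       ((luc (j%:Z + s - 2))%:Q + (luc (2 * j%:Z + s - 1))%:Q) / j.+1%:R).
Proof.
have gibQ (G : int -> int) : gibonacci G -> gibonacci (fun j => (G j)%:Q).
  exact: (gibonacci_raddf (intmul 1)).
have sumQ (G : int -> int) (Grec : gibonacci G) :=
  inv_bin_sum_gibonacci (pchar_num rat) n s (gibQ G Grec).
by split; [exact: sumQ fib_rec | exact: sumQ luc_rec].
Qed.
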